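(* (i) The functor $E^{\mathbf{Set}}\colon\mathbf{Set}\to\mathbf{Chu}(\mathbf{Set},\mathrm{Id})$ defined by $$E^{\mathbf{Set}}_0(X)=(X;X,I_X^X,\mathbf 1),\qquad I_X^X\colon X\times\mathbf 1\to\mathrm{Id}_0(X)=X,\quad I_X^X(x,0)=x\ \ (x\in X),$$ $$E^{\mathbf{Set}}_1(f\colon X\to Y)=(f,f,\mathrm{id}_{\mathbf 1})\colon(X;X,I_X^X,\mathbf 1)\to(Y;Y,I_Y^Y,\mathbf 1),$$ is a strict generalised Chu representation of $\mathbf{Set}$ into $\mathbf{Chu}(\mathbf{Set},\mathrm{Id})$. (ii) The functor $E^{\mathbf{Pred}}\colon\mathbf{Pred}\to\mathbf{Chu}(\mathbf{Set},\mathrm{Id})$ defined by $$E^{\mathbf{Pred}}_0(X,i_A^X,A)=(X;A,I_A^X,\mathbf 1),\qquad I_A^X\colon A\times\mathbf 1\to\mathrm{Id}_0(X)=X,\quad I_A^X(a,0)=i_A^X(a)\ \ (a\in A),$$ $$E^{\mathbf{Pred}}_1\big((u^0,u^+)\colon(X,i_A^X,A)\to(Y,i_B^Y,B)\big)=(u^0,u^+,\mathrm{id}_{\mathbf 1})\colon(X;A,I_A^X,\mathbf 1)\to(Y;B,I_B^Y,\mathbf 1),$$ is a strict generalised Chu representation of $\mathbf{Pred}$ into $\mathbf{Chu}(\mathbf{Set},\mathrm{Id})$. (iii) If $F\colon\mathbf{Set}\to\mathbf{Pred}$ is the full embedding defined by $F_0(X)=(X,\mathrm{id}_X,X)$ and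 $F_1(f\colon X\to Y)=(f,f)$, then $E^{\mathbf{Pred}}\circ F=E^{\mathbf{Set}}$.
   Context: $\mathbf{Set}$ is the category of sets and functions in Bishop's sense (a set $X$ comes with an equality $=_X$, and functions respect equality); $\mathrm{Id}\colon\mathbf{Set}\to\mathbf{Set}$ is the identity functor; $\mathbf 1=\{0\}$. $\mathbf{Pred}$ (category of predicates): objects are triplets $(X,i_A^X,A)$ with $X$ a set and $(A,i_A^X)$ a subset of $X$, i.e. $A$ a set and $i_A^X\colon A\to X$ an injection. A morphism $(X,i_A^X,A)\to(Y,i_B^Y,B)$ is a pair $(u^0,u^+)$ of functions $u^0\colon X\to Y$, $u^+\colon A\to B$ with $u^0\circ i_A^X=i_B^Y\circ u^+$. Composition is componentwise, and identities are $(\mathrm{id}_X,\mathrm{id}_A)$. Generalised Chu category over $\mathbf{Set}$ and an endofunctor $\Gamma\colon\mathbf{Set}\to\mathbf{Set}$: objects of $\mathbf{Chu}(\mathbf{Set},\Gamma)$ are quadruples $(X;A,f,B)$ with $X,A,B$ sets and $f\colon A\times B\to\Gamma_0(X)$; a morphism $(X;A,f,B)\to(Y;C,g,D)$ is a triplet $(\phi^0,\phi^+,\phi^-)$ with $\phi^0\colon X\to Y$, $\phi^+\colon A\to C$, $\phi^-\colon D\to B$ and $\Gamma_1(\phi^0)\circ f\circ(\mathrm{id}_A\times\phi^-)=g\circ(\phi^+\times\mathrm{id}_D)$; $(\theta^0,\theta^+,\theta^-)\circ(\phi^0,\phi^+,\phi^-)=(\theta^0\circ\phi^0,\theta^+\circ\phi^+,\phi^-\circ\theta^-)$,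 and identities are $(\mathrm{id}_X,\mathrm{id}_A,\mathrm{id}_B)$. An embedding is a functor that is injective on objects and faithful; a representation is a full embedding; a generalised Chu representation is a representation whose codomain is a generalised Chu category; it is strict if it is injective on arrows. *)

(* Defs.v *)
From Stdlib Require Import RelationClasses Relation_Definitions Setoid Morphisms Eqdep.

Set Implicit Arguments.
Unset Strict Implicit.
#[local] Obligation Tactic := idtac.
Local Ltac splits := hnf; repeat lazymatch goal with |- _ /\ _ => split end.

Record bset := BSet {
  carrier :> Type;
  eqS : relation carrier;
  eqS_equiv : Equivalence eqS
}.
#[global] Existing Instance eqS_equiv.
Arguments eqS {_} _ _.

Notation "x == y" := (eqS x y) (at level 70, no associativity).

Record bfun (X Y : bset) := BFun {
  ap :> X -> Y;
  ap_proper : Proper (eqS ==> eqS) ap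
}.
Arguments BFun {X Y} ap ap_proper.
#[global] Existing Instance ap_proper.

Program Definition fun_set (X Y : bset) : bset :=
  {| carrier := bfun X Y; eqS := fun f g => forall x, f x == g x |}.
Next Obligation.
  intros X Y; split.
  - intros f x; reflexivity.
  - intros f g H x; symmetry; apply H.
  - intros f g h H K x; transitivity (g x); auto.
Qed.

Program Definition bid (X : bset) : bfun X X := {| ap := fun x => x |}.
Next Obligation. intros X x y H; exact H. Qed.

Program Definition bcomp (X Y Z : bset) (g : bfun Y Z) (f : bfun X Y) : bfun X Z :=
  {| ap := fun x => g (f x) |}.
Next Obligation. intros X Y Z g f x y H; now rewrite H. Qed.

Program Definition bprod (X Y : bset) : bset :=
  {| carrier := X * Y; eqS := fun p q => fst p == fst q /\ snd p == snd q |}.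
Next Obligation.
  intros X Y; split.
  - intros p; split; reflexivity.
  - intros p q [H K]; split; now symmetry.
  - intros p q r [H K] [H' K']; split; [now rewrite H | now rewrite K].
Qed.

Program Definition bprod_map (A B C D : bset) (f : bfun A C) (g : bfun B D) :
    bfun (bprod A B) (bprod C D) :=
  {| ap := fun p => (f (fst p), g (snd p)) |}.
Next Obligation. intros A B C D f g p q [H K]; split; cbn; [now rewrite H | now rewrite K]. Qed.

Definition bone : bset := {| carrier := unit; eqS := eq; eqS_equiv := eq_equivalence |}.

Definition injective (X Y : bset) (f : bfun X Y) : Prop :=
  forall x y, f x == f y -> x == y.

(** Two sets are equal when they are identical.  A function [f] equals a function
    [g], possibly with another (syntactic) domain or codomain, when these coincide
    and [f], [g] agree pointwise up to the equality of the codomain; two distinct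
    terms for the same function are thereby identified. *)
Inductive same_fun (X Y : bset) (f : bfun X Y) :
    forall X' Y' : bset, bfun X' Y' -> Prop :=
  SameFun : forall g : bfun X Y, (forall x, f x == g x) -> same_fun f g.

Lemma same_fun_refl X Y (f : bfun X Y) : same_fun f f.
Proof. constructor; reflexivity. Qed.

Lemma same_fun_sym X Y (f : bfun X Y) X' Y' (g : bfun X' Y') :
  same_fun f g -> same_fun g f.
Proof. intros [h H]; constructor; intros x; symmetry; apply H. Qed.

Lemma same_fun_trans X Y (f : bfun X Y) X' Y' (g : bfun X' Y')
    X'' Y'' (h : bfun X'' Y'') :
  same_fun f g -> same_fun g h -> same_fun f h.
Proof.
  intros [g' H] [h' K]; constructor; intros x; now rewrite H.
Qed.

Lemma same_fun_dom X Y (f : bfun X Y) X' Y' (g : bfun X' Y') : same_fun f g -> X = X'.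
Proof. now intros []. Qed.

Lemma same_fun_cod X Y (f : bfun X Y) X' Y' (g : bfun X' Y') : same_fun f g -> Y = Y'.
Proof. now intros []. Qed.

Lemma same_fun_ext (X Y : bset) (f g : bfun X Y) :
  same_fun f g <-> (forall x, f x == g x).
Proof.
  split; [ | now constructor ].
  intros H.
  pose (T := fun p : bset * bset => bfun (fst p) (snd p)).
  assert (G : forall X' Y' (h : bfun X' Y'), same_fun f h ->
             exists f' : bfun X Y, (forall x, f x == f' x) /\
               existT T (X, Y) f' = existT T (X', Y') h).
  { intros X' Y' h [h' K]; now exists h'. }
  destruct (G _ _ _ H) as (f' & K & E).
  now rewrite <- (inj_pair2 _ T _ _ _ E).
Qed.

Lemma same_fun_comp X Y Z (f : bfun X Y) (g : bfun Y Z)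
    X' Y' Z' (f' : bfun X' Y') (g' : bfun Y' Z') :
  same_fun f f' -> same_fun g g' -> same_fun (bcomp g f) (bcomp g' f').
Proof.
  intros H K.
  pose proof (same_fun_dom H); pose proof (same_fun_cod H); pose proof (same_fun_cod K); subst.
  pose proof (proj1 (same_fun_ext _ _) H) as H'.
  pose proof (proj1 (same_fun_ext _ _) K) as K'.
  apply same_fun_ext; intros x; cbn; now rewrite (H' x).
Qed.

(** The class of objects carries an equality [ob_eq], each hom-class is a set, and
    [arr_eq] is the equality on the class of all arrows: it compares arrows whose
    domains and codomains are equal objects and restricts to the equality of each
    hom-set. *)
Record category := Category {
  ob :> Type;
  ob_eq : relation ob;
  hom : ob -> ob -> bset;
  arr_eq : forall {a b c d : ob}, hom a b -> hom c d -> Prop;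
  idt : forall a, hom a a;
  comp : forall {a b c}, hom b c -> hom a b -> hom a c;
  ob_eq_equiv : Equivalence ob_eq;
  comp_assoc : forall a b c d (h : hom c d) (g : hom b c) (f : hom a b),
    comp h (comp g f) == comp (comp h g) f;
  comp_idl : forall a b (f : hom a b), comp (idt b) f == f;
  comp_idr : forall a b (f : hom a b), comp f (idt a) == f;
  arr_eq_hom : forall a b (f g : hom a b), arr_eq f g <-> f == g;
  arr_eq_sym : forall a b c d (f : hom a b) (g : hom c d), arr_eq f g -> arr_eq g f;
  arr_eq_trans : forall a b c d a' b' (f : hom a b) (g : hom c d) (h : hom a' b'),
    arr_eq f g -> arr_eq g h -> arr_eq f h;
  arr_eq_dom : forall a b c d (f : hom a b) (g : hom c d), arr_eq f g -> ob_eq a c;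
  arr_eq_cod : forall a b c d (f : hom a b) (g : hom c d), arr_eq f g -> ob_eq b d;
  arr_eq_idt : forall a b, ob_eq a b -> arr_eq (idt a) (idt b);
  arr_eq_comp : forall a b c a' b' c' (g : hom b c) (f : hom a b)
      (g' : hom b' c') (f' : hom a' b'),
    arr_eq g g' -> arr_eq f f' -> arr_eq (comp g f) (comp g' f')
}.
Arguments ob_eq {_} _ _.
Arguments hom {_} _ _.
Arguments arr_eq {_ _ _ _ _} _ _.
Arguments idt {_} _.
Arguments comp {_ _ _ _} _ _.

Record functor (C D : category) := Functor {
  fob : C -> D;
  farr : forall {a b : C}, hom a b -> hom (fob a) (fob b);
  fob_eq : forall a b, ob_eq a b -> ob_eq (fob a) (fob b);
  farr_eq : forall a b c d (f : hom a b) (g : hom c d),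
    arr_eq f g -> arr_eq (farr f) (farr g);
  farr_idt : forall a, farr (idt a) == idt (fob a);
  farr_comp : forall a b c (g : hom b c) (f : hom a b),
    farr (comp g f) == comp (farr g) (farr f)
}.
Arguments fob {_ _} _ _.
Arguments farr {_ _} _ {_ _} _.

Lemma farr_hom (C D : category) (F : functor C D) (a b : C) (f g : hom a b) :
  f == g -> farr F f == farr F g.
Proof. intros H; apply arr_eq_hom, farr_eq, arr_eq_hom, H. Qed.

Program Definition functor_id (C : category) : functor C C :=
  {| fob := fun a => a; farr := fun a b f => f |}.
Next Obligation. auto. Qed.
Next Obligation. auto. Qed.
Next Obligation. intros C a; cbn; reflexivity. Qed.
Next Obligation. intros C a b c g f; cbn; reflexivity. Qed.

Program Definition functor_comp (C D E : category) (G : functor D E) (F : functor C D) :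
    functor C E :=
  {| fob := fun a => fob G (fob F a); farr := fun a b f => farr G (farr F f) |}.
Next Obligation. intros; now apply fob_eq, fob_eq. Qed.
Next Obligation. intros; now apply farr_eq, farr_eq. Qed.
Next Obligation.
  intros C D E G F a; cbn; rewrite <- farr_idt; apply farr_hom, farr_idt.
Qed.
Next Obligation.
  intros C D E G F a b c g f; cbn; rewrite <- farr_comp; apply farr_hom, farr_comp.
Qed.

Definition functor_eq (C D : category) (F G : functor C D) : Prop :=
  (forall a : C, ob_eq (fob F a) (fob G a)) /\
  (forall (a b : C) (f : hom a b), arr_eq (farr F f) (farr G f)).

Definition injective_on_objects (C D : category) (F : functor C D) : Prop :=
  forall a b : C, ob_eq (fob F a) (fob F b) -> ob_eq a b.

Definition injective_on_arrows (C D : category) (F : functor C D) : Prop :=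
  forall (a b c d : C) (f : hom a b) (g : hom c d),
    arr_eq (farr F f) (farr F g) -> arr_eq f g.

Definition faithful (C D : category) (F : functor C D) : Prop :=
  forall (a b : C) (f g : hom a b), farr F f == farr F g -> f == g.

Definition full (C D : category) (F : functor C D) : Prop :=
  forall (a b : C) (g : hom (fob F a) (fob F b)), exists f : hom a b, farr F f == g.

Definition embedding (C D : category) (F : functor C D) : Prop :=
  injective_on_objects F /\ faithful F.

Definition representation (C D : category) (F : functor C D) : Prop :=
  full F /\ embedding F.

Program Definition SET : category :=
  {| ob := bset; ob_eq := eq; hom := fun_set;
     arr_eq := fun X Y X' Y' f g => same_fun f g;
     idt := bid; comp := fun X Y Z g f => bcomp g f |}.
Next Obligation. intros; intros x; reflexivity. Qed.
Next Obligation. intros; intros x; reflexivity. Qed.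
Next Obligation. intros; intros x; reflexivity. Qed.
Next Obligation. intros X Y f g; apply same_fun_ext. Qed.
Next Obligation. intros X Y X' Y' f g; apply same_fun_sym. Qed.
Next Obligation. intros X Y X' Y' X'' Y'' f g h; apply same_fun_trans. Qed.
Next Obligation. intros X Y X' Y' f g; apply same_fun_dom. Qed.
Next Obligation. intros X Y X' Y' f g; apply same_fun_cod. Qed.
Next Obligation. intros X Y []; apply same_fun_refl. Qed.
Next Obligation. intros; now apply same_fun_comp. Qed.

Record predicate := Predicate {
  pset : bset;
  psub : bset;
  pincl : bfun psub pset;
  pincl_inj : injective pincl
}.

Record pred_mor (P Q : predicate) := PredMor {
  pm0 : bfun (pset P) (pset Q);
  pmp : bfun (psub P) (psub Q);
  pm_comm : (bcomp pm0 (pincl P) : fun_set _ _) == bcomp (pincl Q) pmp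
}.

Program Definition pred_hom (P Q : predicate) : bset :=
  {| carrier := pred_mor P Q;
     eqS := fun u v => (pm0 u : fun_set _ _) == pm0 v /\ (pmp u : fun_set _ _) == pmp v |}.
Next Obligation.
  intros P Q; split.
  - intros u; split; reflexivity.
  - intros u v [H K]; split; now symmetry.
  - intros u v w [H K] [H' K']; split; etransitivity; eauto.
Qed.

Program Definition pred_id (P : predicate) : pred_mor P P :=
  {| pm0 := bid _; pmp := bid _ |}.
Next Obligation. intros P a; reflexivity. Qed.

Program Definition pred_comp (P Q R : predicate) (v : pred_mor Q R) (u : pred_mor P Q) :
    pred_mor P R :=
  {| pm0 := bcomp (pm0 v) (pm0 u); pmp := bcomp (pmp v) (pmp u) |}.
Next Obligation.
  intros P Q R v u a.
  pose proof (pm_comm u a) as H; pose proof (pm_comm v (pmp u a)) as K; cbn in *.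
  now rewrite H.
Qed.

(** Equality of the triplets [(X, i, A)]; [same_fun] includes the equality of the
    sets involved. *)
Definition pred_eq (P Q : predicate) : Prop := same_fun (pincl P) (pincl Q).

Definition pred_arr_eq (P Q P' Q' : predicate) (u : pred_mor P Q) (v : pred_mor P' Q') :
    Prop :=
  pred_eq P P' /\ pred_eq Q Q' /\ same_fun (pm0 u) (pm0 v) /\ same_fun (pmp u) (pmp v).

Program Definition PRED : category :=
  {| ob := predicate; ob_eq := pred_eq; hom := pred_hom;
     arr_eq := fun P Q P' Q' u v => pred_arr_eq u v;
     idt := pred_id; comp := fun P Q R v u => pred_comp v u |}.
Next Obligation.
  split.
  - intros P; apply same_fun_refl.
  - intros P Q; apply same_fun_sym.
  - intros P Q R; apply same_fun_trans.
Qed.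
Next Obligation. intros; split; intros x; reflexivity. Qed.
Next Obligation. intros; split; intros x; reflexivity. Qed.
Next Obligation. intros; split; intros x; reflexivity. Qed.
Next Obligation.
  intros P Q u v; split.
  - intros (_ & _ & H & K); split;
      [exact (proj1 (same_fun_ext _ _) H) | exact (proj1 (same_fun_ext _ _) K)].
  - intros [H K]; split; [apply same_fun_refl | split; [apply same_fun_refl | ]]; split;
      [exact (proj2 (same_fun_ext _ _) H) | exact (proj2 (same_fun_ext _ _) K)].
Qed.
Next Obligation.
  intros P Q P' Q' u v (H1 & H2 & H3 & H4); splits; now apply same_fun_sym.
Qed.
Next Obligation.
  intros P Q P' Q' P'' Q'' u v w (H1 & H2 & H3 & H4) (K1 & K2 & K3 & K4);
    splits; eapply same_fun_trans; eassumption.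
Qed.
Next Obligation. now intros P Q P' Q' u v (H1 & H2 & H3 & H4). Qed.
Next Obligation. now intros P Q P' Q' u v (H1 & H2 & H3 & H4). Qed.
Next Obligation.
  intros P Q H; splits; auto; cbn.
  - destruct (same_fun_cod H); apply same_fun_refl.
  - destruct (same_fun_dom H); apply same_fun_refl.
Qed.
Next Obligation.
  intros P Q R P' Q' R' v u v' u' (H1 & H2 & H3 & H4) (K1 & K2 & K3 & K4).
  splits; auto; now apply same_fun_comp.
Qed.

Section Chu.
Variable Gam : functor SET SET.

Record chu_space := ChuSpace {
  cset : bset;
  cpos : bset;
  cneg : bset;
  cform : bfun (bprod cpos cneg) (fob Gam cset)
}.

Record chu_mor (P Q : chu_space) := ChuMor {
  cm0 : bfun (cset P) (cset Q);
  cmp : bfun (cpos P) (cpos Q);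
  cmm : bfun (cneg Q) (cneg P);
  cm_comm :
    (bcomp (bcomp (farr Gam (cm0 : @hom SET _ _)) (cform P)) (bprod_map (bid (cpos P)) cmm)
      : fun_set _ _)
    == bcomp (cform Q) (bprod_map cmp (bid (cneg Q)))
}.

Program Definition chu_hom (P Q : chu_space) : bset :=
  {| carrier := chu_mor P Q;
     eqS := fun u v => (cm0 u : fun_set _ _) == cm0 v /\
                       (cmp u : fun_set _ _) == cmp v /\
                       (cmm u : fun_set _ _) == cmm v |}.
Next Obligation.
  intros P Q; split.
  - intros u; splits; reflexivity.
  - intros u v (H & K & L); splits; now symmetry.
  - intros u v w (H & K & L) (H' & K' & L'); splits; etransitivity; eauto.
Qed.

Program Definition chu_id (P : chu_space) : chu_mor P P :=
  {| cm0 := bid _; cmp := bid _; cmm := bid _ |}.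
Next Obligation.
  intros P [a b]; cbn.
  exact (farr_idt Gam (cset P) (cform P (a, b))).
Qed.

Program Definition chu_comp (P Q R : chu_space) (v : chu_mor Q R) (u : chu_mor P Q) :
    chu_mor P R :=
  {| cm0 := bcomp (cm0 v) (cm0 u); cmp := bcomp (cmp v) (cmp u);
     cmm := bcomp (cmm u) (cmm v) |}.
Next Obligation.
  intros P Q R v u [a d].
  pose proof (cm_comm u (a, cmm v d)) as H.
  pose proof (cm_comm v (cmp u a, d)) as K.
  pose proof (@farr_comp _ _ Gam (cset P) (cset Q) (cset R) (cm0 v) (cm0 u)
                (cform P (a, cmm u (cmm v d)))) as L.
  cbn in *.
  etransitivity; [exact L | etransitivity; [ | exact K]].
  now apply ap_proper.
Qed.

(** The equalities of the sets are listed because that of two products, or of two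
    values of [Gam], does not imply the one of their arguments. *)
Definition chu_eq (P Q : chu_space) : Prop :=
  cset P = cset Q /\ cpos P = cpos Q /\ cneg P = cneg Q /\
  same_fun (cform P) (cform Q).

Definition chu_arr_eq (P Q P' Q' : chu_space) (u : chu_mor P Q) (v : chu_mor P' Q') :
    Prop :=
  chu_eq P P' /\ chu_eq Q Q' /\
  same_fun (cm0 u) (cm0 v) /\ same_fun (cmp u) (cmp v) /\ same_fun (cmm u) (cmm v).

Lemma chu_eq_equiv : Equivalence chu_eq.
Proof.
  split.
  - intros P; splits; auto using same_fun_refl.
  - intros P Q (H1 & H2 & H3 & H4); splits; auto; now apply same_fun_sym.
  - intros P Q R (H1 & H2 & H3 & H4) (K1 & K2 & K3 & K4).
    splits; try congruence; eapply same_fun_trans; eassumption.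
Qed.

Program Definition CHU : category :=
  {| ob := chu_space; ob_eq := chu_eq; hom := chu_hom;
     arr_eq := fun P Q P' Q' u v => chu_arr_eq u v;
     idt := chu_id; comp := fun P Q R v u => chu_comp v u |}.
Next Obligation. exact chu_eq_equiv. Qed.
Next Obligation. intros; splits; intros x; reflexivity. Qed.
Next Obligation. intros; splits; intros x; reflexivity. Qed.
Next Obligation. intros; splits; intros x; reflexivity. Qed.
Next Obligation.
  intros P Q u v; split.
  - intros (_ & _ & H & K & L).
    split; [exact (proj1 (same_fun_ext _ _) H) | ].
    split; [exact (proj1 (same_fun_ext _ _) K) | exact (proj1 (same_fun_ext _ _) L)].
  - intros (H & K & L).
    split; [apply chu_eq_equiv | split; [apply chu_eq_equiv | ]].
    split; [exact (proj2 (same_fun_ext _ _) H) | ].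
    split; [exact (proj2 (same_fun_ext _ _) K) | exact (proj2 (same_fun_ext _ _) L)].
Qed.
Next Obligation.
  intros P Q P' Q' u v (H1 & H2 & H3 & H4 & H5).
  split; [now apply chu_eq_equiv | split; [now apply chu_eq_equiv | ]].
  splits; now apply same_fun_sym.
Qed.
Next Obligation.
  intros P Q P' Q' P'' Q'' u v w (H1 & H2 & H3 & H4 & H5) (K1 & K2 & K3 & K4 & K5).
  split; [now apply (chu_eq_equiv.(Equivalence_Transitive) _ P') | ].
  split; [now apply (chu_eq_equiv.(Equivalence_Transitive) _ Q') | ].
  splits; eapply same_fun_trans; eassumption.
Qed.
Next Obligation. now intros P Q P' Q' u v (H1 & H2 & _). Qed.
Next Obligation. now intros P Q P' Q' u v (H1 & H2 & _). Qed.
Next Obligation.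
  intros P Q H; split; [exact H | split; [exact H | ]].
  destruct H as (H1 & H2 & H3 & _); cbn.
  destruct H1, H2, H3; splits; apply same_fun_refl.
Qed.
Next Obligation.
  intros P Q R P' Q' R' v u v' u' (H1 & H2 & H3 & H4 & H5) (K1 & K2 & K3 & K4 & K5).
  split; [exact K1 | split; [exact H2 | ]].
  splits; now apply same_fun_comp.
Qed.

End Chu.

(** Being a Chu representation beyond being a representation is a condition on the
    codomain, which is expressed by the type of [F]. *)
Definition chu_representation (C : category) (Gam : functor SET SET)
    (F : functor C (CHU Gam)) : Prop :=
  representation F.

Definition strict_chu_representation (C : category) (Gam : functor SET SET)
    (F : functor C (CHU Gam)) : Prop :=
  chu_representation F /\ injective_on_arrows F.

Program Definition I_of (A X : bset) (i : bfun A X) : bfun (bprod A bone) X :=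
  {| ap := fun p => i (fst p) |}.
Next Obligation. intros A X i p q [H _]; now rewrite H. Qed.

Lemma same_fun_I_of A X (i : bfun A X) A' X' (j : bfun A' X') :
  same_fun i j -> same_fun (I_of i) (I_of j).
Proof. intros [h H]; apply same_fun_ext; intros p; apply H. Qed.

Definition ESet0 (X : bset) : chu_space (functor_id SET) :=
  @ChuSpace (functor_id SET) X X bone (I_of (bid X)).

Program Definition ESet1 (X Y : bset) (f : bfun X Y) : chu_mor (ESet0 X) (ESet0 Y) :=
  {| cm0 := f; cmp := f; cmm := bid bone |}.
Next Obligation. intros X Y f [x z]; cbn; reflexivity. Qed.

Program Definition ESet : functor SET (CHU (functor_id SET)) :=
  {| fob := ESet0; farr := fun X Y f => ESet1 f |}.
Next Obligation. intros X Y []; apply chu_eq_equiv. Qed.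
Next Obligation.
  intros X Y X' Y' f g H; cbn in *.
  pose proof (same_fun_dom H); pose proof (same_fun_cod H); subst.
  split; [apply chu_eq_equiv | split; [apply chu_eq_equiv | ]].
  splits; auto; apply same_fun_refl.
Qed.
Next Obligation. intros X; splits; intros x; reflexivity. Qed.
Next Obligation. intros X Y Z g f; splits; intros x; reflexivity. Qed.

Definition EPred0 (P : predicate) : chu_space (functor_id SET) :=
  @ChuSpace (functor_id SET) (pset P) (psub P) bone (I_of (pincl P)).

Program Definition EPred1 (P Q : predicate) (u : pred_mor P Q) :
    chu_mor (EPred0 P) (EPred0 Q) :=
  {| cm0 := pm0 u; cmp := pmp u; cmm := bid bone |}.
Next Obligation. intros P Q u [a z]; exact (pm_comm u a). Qed.

Lemma EPred0_eq (P Q : predicate) : pred_eq P Q -> chu_eq (EPred0 P) (EPred0 Q).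
Proof.
  intros H; split; [exact (same_fun_cod H) | split; [exact (same_fun_dom H) | ]].
  split; [reflexivity | exact (same_fun_I_of H)].
Qed.

Program Definition EPred : functor PRED (CHU (functor_id SET)) :=
  {| fob := EPred0; farr := fun P Q u => EPred1 u |}.
Next Obligation. exact EPred0_eq. Qed.
Next Obligation.
  intros P Q P' Q' u v (H1 & H2 & H3 & H4).
  split; [now apply EPred0_eq | split; [now apply EPred0_eq | ]].
  splits; auto; apply same_fun_refl.
Qed.
Next Obligation. intros P; splits; intros x; reflexivity. Qed.
Next Obligation. intros P Q R v u; splits; intros x; reflexivity. Qed.

Program Definition FSetPred0 (X : bset) : predicate :=
  {| pset := X; psub := X; pincl := bid X |}.
Next Obligation. intros X x y H; exact H. Qed.

Program Definition FSetPred1 (X Y : bset) (f : bfun X Y) :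
    pred_mor (FSetPred0 X) (FSetPred0 Y) :=
  {| pm0 := f; pmp := f |}.
Next Obligation. intros X Y f x; cbn; reflexivity. Qed.

Program Definition FSetPred : functor SET PRED :=
  {| fob := FSetPred0; farr := fun X Y f => FSetPred1 f |}.
Next Obligation. intros X Y []; apply same_fun_refl. Qed.
Next Obligation.
  intros X Y X' Y' f g H; cbn in *.
  pose proof (same_fun_dom H); pose proof (same_fun_cod H); subst.
  split; [apply same_fun_refl | split; [apply same_fun_refl | ]]; now split.
Qed.
Next Obligation. intros X; split; intros x; reflexivity. Qed.
Next Obligation. intros X Y Z g f; split; intros x; reflexivity. Qed.

(* Main.v *)
Require Import Defs.

Set Implicit Arguments.
Unset Strict Implicit.

(** Over the identity functor, a space with negative part [bone] is just a function
    [A -> X], and the only endofunction of [bone] is the identity.  For a morphism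
    [(phi0, phi+, phi-)] between two such spaces, [phi-] therefore carries no
    information, and the compatibility condition at [(a, tt)] reads
    [phi0 (i a) == j (phi+ a)], which is exactly the condition on a morphism of
    predicates.  This gives fullness of [EPred].  When [i] and [j] are identities the
    condition says [phi0 == phi+], which gives fullness of [ESet] and, in the same
    way, of [FSetPred].

    Everything else reduces to injectivity on arrows: as identities determine their
    objects and hom-sets carry the equality of arrows, a functor that is injective on
    arrows is an embedding ([injective_on_arrows_embedding]).  This injectivity holds
    because the images keep the components of the arrows; for [EPred] it also uses
    that the inclusion of a subset is recovered from the induced form
    ([same_fun_I_of_inv]). *)

(** Injectivity on objects comes from applying the hypothesis to identities,
    faithfulness from applying it to parallel arrows. *)
Lemma injective_on_arrows_embedding (C D : category) (F : functor C D) :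
  injective_on_arrows F -> embedding F.
Proof.
  intros HF; split.
  - intros a b Hab.
    apply (@arr_eq_dom C a a b b (idt a) (idt b)), HF.
    apply arr_eq_trans with (g := idt (fob F a)).
    + apply arr_eq_hom, farr_idt.
    + apply arr_eq_trans with (g := idt (fob F b)).
      * now apply arr_eq_idt.
      * apply arr_eq_sym, arr_eq_hom, farr_idt.
  - intros a b f g Hfg.
    apply arr_eq_hom, HF, arr_eq_hom, Hfg.
Qed.

Lemma full_injective_strict_chu_representation (C : category) (Gam : functor SET SET)
    (F : functor C (CHU Gam)) :
  full F -> injective_on_arrows F -> strict_chu_representation F.
Proof.
  intros Hfull Hinj.
  split; [split; [exact Hfull | now apply injective_on_arrows_embedding] | exact Hinj].
Qed.

Lemma bone_eq (x y : bone) : x == y.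
Proof. now destruct x, y. Qed.

(** The domains are assumed equal because [bprod A bone = bprod A' bone] does not
    yield [A = A'].  Once they are identified, the two forms can be evaluated at
    [(a, tt)]. *)
Lemma same_fun_I_of_inv (A X A' X' : bset) (i : bfun A X) (j : bfun A' X') :
  A = A' -> same_fun (I_of i) (I_of j) -> same_fun i j.
Proof.
  intros HA H.
  pose proof (same_fun_cod H) as HX; subst.
  apply same_fun_ext; intros a.
  exact (proj1 (same_fun_ext _ _) H (a, tt)).
Qed.

Lemma EPred0_inj (P Q : predicate) : chu_eq (EPred0 P) (EPred0 Q) -> pred_eq P Q.
Proof.
  intros (_ & HA & _ & H).
  exact (same_fun_I_of_inv HA H).
Qed.

Lemma ESet_full : full ESet.
Proof.
  intros X Y g; exists (cm0 g).
  split; [ | split].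
  - intros x; reflexivity.
  - intros x; exact (cm_comm g (x, tt)).
  - intros z; apply bone_eq.
Qed.

Lemma ESet_injective_on_arrows : injective_on_arrows ESet.
Proof. intros X Y X' Y' f g (_ & _ & H & _); exact H. Qed.

Lemma EPred_full : full EPred.
Proof.
  intros P Q g.
  exists (@PredMor P Q (cm0 g) (cmp g) (fun a => cm_comm g (a, tt))).
  split; [ | split].
  - intros x; reflexivity.
  - intros a; reflexivity.
  - intros z; apply bone_eq.
Qed.

Lemma EPred_injective_on_arrows : injective_on_arrows EPred.
Proof.
  intros P Q P' Q' u v (HP & HQ & H0 & Hp & _).
  split; [exact (EPred0_inj HP) | split; [exact (EPred0_inj HQ) | ]].
  split; [exact H0 | exact Hp].
Qed.

Lemma FSetPred_full : full FSetPred.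
Proof.
  intros X Y u; exists (pm0 u).
  split.
  - intros x; reflexivity.
  - intros x; exact (pm_comm u x).
Qed.

Lemma FSetPred_injective_on_arrows : injective_on_arrows FSetPred.
Proof. intros X Y X' Y' f g (_ & _ & H & _); exact H. Qed.

(** Both functors send [X] to literally the same space, and [f] to morphisms with the
    same three components; only the proofs of the compatibility condition differ, and
    the equality of morphisms ignores them. *)
Lemma EPred_FSetPred_eq : functor_eq (functor_comp EPred FSetPred) ESet.
Proof.
  split.
  - intros X; apply chu_eq_equiv.
  - intros X Y f.
    split; [apply chu_eq_equiv | split; [apply chu_eq_equiv | ]].
    split; [ | split]; apply same_fun_refl.
Qed.

Theorem proposition10p2 :
  strict_chu_representation ESet /\
  strict_chu_representation EPred /\
  (full FSetPred /\ embedding FSetPred /\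
   functor_eq (functor_comp EPred FSetPred) ESet).
Proof.
  split; [ | split; [ | split; [ | split]]].
  - exact (full_injective_strict_chu_representation
             ESet_full ESet_injective_on_arrows).
  - exact (full_injective_strict_chu_representation
             EPred_full EPred_injective_on_arrows).
  - exact FSetPred_full.
  - exact (injective_on_arrows_embedding FSetPred_injective_on_arrows).
  - exact EPred_FSetPred_eq.
Qed.
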